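(* For every non-negative integer $n$ and every positive integer $m$, the integer \[ S(2n,m)=\sum_{k=0}^{2n}(-1)^k\binom{2n}{k}^m C(2n,k)\, C(2n,2n-k) \] is divisible by $C^{(3)}_n=\frac{1}{2n+1}\binom{3n}{n}$.
   Context: For integers $0\le k\le N$, $C(N,k)=\frac{N-k+1}{N+1}\binom{N+k}{N}$ (the Catalan triangle: the number of lattice paths from $(0,0)$ to $(N,k)$ with steps $(1,0)$ and $(0,1)$ never rising above $y=x$). $C^{(3)}_n=\frac{1}{2n+1}\binom{3n}{n}$ is the Fuss--Catalan number of order three. *)

(* Defs.v *)
From mathcomp Require Import all_boot all_order all_algebra.
Set Implicit Arguments.
Unset Strict Implicit.
Unset Printing Implicit Defensive.
Import GRing.Theory.

(* Natural-number quotients; both are exact, see [catalan_triangleE] (on the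
   range k <= N, where the triangle is defined) and [fuss_catalan3E]. *)
Definition catalan_triangle (N k : nat) : nat :=
  (((N - k + 1) * 'C(N + k, N)) %/ (N + 1))%N.

Definition fuss_catalan3 (n : nat) : nat :=
  ('C(3 * n, n) %/ (2 * n + 1))%N.

Local Open Scope ring_scope.

Definition catalan_sum (N m : nat) : int :=
  \sum_(0 <= k < N.+1)
    (-1) ^+ k * ('C(N, k) ^ m * catalan_triangle N k
                 * catalan_triangle N (N - k))%N%:Z.

Local Close Scope ring_scope.

Lemma catalan_triangleE (N k : nat) : k <= N ->
  catalan_triangle N k * (N + 1) = (N - k + 1) * 'C(N + k, N).
Proof.
move=> le_kN; apply: divnK; rewrite !addn1.
case: k le_kN => [|k] le_kN; first by rewrite subn0 addn0 binn muln1.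
have E : N.+1 * 'C(N + k.+1, N.+1) = k.+1 * 'C(N + k.+1, N).
  by rewrite mul_bin_left addKn.
rewrite -(subSn le_kN) mulnBl -E -mulnBr; exact: dvdn_mulr.
Qed.

Lemma fuss_catalan3E (n : nat) :
  fuss_catalan3 n * (2 * n + 1) = 'C(3 * n, n).
Proof.
apply: divnK; case: n => [|n] //.
have E : n.+1 * 'C(3 * n.+1, n.+1) = (2 * n.+1 + 1) * 'C(3 * n.+1, n).
  rewrite mul_bin_left; congr (_ * _).
  by rewrite [3 * _]mulSn addSn -addnS addKn addn1.
have co : coprime (2 * n.+1 + 1) n.+1.
  by rewrite /coprime gcdnC gcdnMDl gcdn1.
by rewrite -(Gauss_dvdr _ co) E dvdn_mulr.
Qed.

(* Main.v *)
(** With N = 2n and the trinomial weights w_j(i) = (N-j)! / (j! (i-j)! (N-i-j)!),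
    put T(m,j) = \sum_i binom(N,i)^m w_j(i) F(i), where
    F(i) = (-1)^i C(N,i) C(N,N-i); the sum S(N,m+1) is T(m,0).  By Vandermonde,
    binom(N,i) w_j(i) is a nonnegative integer combination of the w_(j+u)(i), so
    a common divisor of all the T(0,j) divides every T(m,j).  Up to the factor
    (N-i+1)(i+1)/(N+1)^2, T(0,j) is a well-poised alternating sum of Dixon type,
    whose closed form is found by a two-term recurrence in the exponent d of
    binom(d+i,d) binom(d+2a-i,d).  This gives, for j <= n,
    T(0,j) = (-1)^n (j+1) C^(3)_n
             (C(N,j) binom(N,n-j) + C(N,j+1) binom(N,n-j-1)),
    where the last binomial is read as 0 for j = n, and T(0,j) = 0 for j > n. *)

Require Import Defs.
From mathcomp Require Import all_boot all_order all_algebra.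
From mathcomp Require Import zify ring.
Import GRing.Theory.

(** * Binomial products and the trinomial weights *)

Lemma bin_mul_bin (n i k : nat) :
  ('C(n, i + k) * 'C(i + k, k) = 'C(n, k) * 'C(n - k, i))%N.
Proof.
case: (leqP (i + k) n) => [le_n|lt_n]; last first.
  rewrite bin_small // mul0n; case: (leqP k n) => [le_kn|lt_nk].
    by rewrite (@bin_small (n - k)) ?muln0 // ltn_subLR // addnC.
  by rewrite bin_small.
have [r ->] : exists r, n = (i + k + r)%N by exists (n - (i + k))%N; lia.
have E1 := @bin_fact (i + k + r) (i + k) (leq_addr _ _).
have E2 := @bin_fact (i + k) k (leq_addl _ _).
have E3 : 'C(i + k + r, k) * (k`! * (i + r)`!) = (i + k + r)`!.
  rewrite -(@bin_fact (i + k + r) k); last lia.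
  by congr (_ * (_ * _`!)); lia.
have E4 := @bin_fact (i + r) i (leq_addr _ _).
rewrite addKn in E1; rewrite addnK in E2; rewrite addKn in E4.
have -> : (i + k + r - k = i + r)%N by lia.
have p : 0 < k`! * (i`! * r`!) by rewrite !muln_gt0 !fact_gt0.
apply/eqP; rewrite -(eqn_pmul2r p); apply/eqP.
transitivity ((i + k + r)`!).
  by rewrite -E1 -E2; ring.
by rewrite -E3 -E4; ring.
Qed.

Lemma bin_mul_binC (n i k : nat) :
  ('C(n, k) * 'C(n - k, i) = 'C(n, i) * 'C(n - i, k))%N.
Proof.
rewrite -!bin_mul_bin addnC; congr (_ * _)%N.
by rewrite -[in RHS]bin_sub ?leq_addl // addnK.
Qed.

(* The multinomial coefficient (N - j)! / (j! (i - j)! (N - i - j)!), extended by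
   0 when i < j or i + j > N. *)
Definition trinom (N j i : nat) : nat := 'C(N - j, i) * 'C(i, j).

Lemma trinom_gt (N j i : nat) : N < 2 * j -> trinom N j i = 0.
Proof.
move=> lt_Nj; rewrite /trinom.
case: (ltnP i j) => [lt_ij|le_ji]; first by rewrite (@bin_small i) ?muln0.
by rewrite (@bin_small (N - j)) //; lia.
Qed.

(** Pulling out C(N,j) C(N-j,i) leaves the sum over u of C(N-j-i,u) C(i,i-j-u), which Vandermonde
    evaluates as C(N-j,i-j). *)
Lemma trinom_expand (N j i : nat) : i <= N ->
  'C(N, i) * trinom N j i =
    \sum_(u < N.+1) 'C(N, j) * 'C(N - j, u) * trinom N (j + u) i.
Proof.
move=> le_iN; rewrite /trinom.
case: (ltnP i j) => [lt_ij|le_ji].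
  rewrite (@bin_small i) // !muln0 big1 // => u _.
  by rewrite (@bin_small i) ?muln0 // ltn_addr.
have [e ei] : exists e, i = (e + j)%N by exists (i - j)%N; rewrite subnK.
transitivity ('C(N, j) * 'C(N - j, i) * \sum_(u < N.+1)
    'C(N - j - i, u) * 'C(i, j + u))%N; last first.
  rewrite big_distrr; apply: eq_bigr => u _ /=.
  rewrite subnDA -!mulnA; congr (_ * _)%N.
  by rewrite !mulnA bin_mul_binC.
have -> : (\sum_(u < N.+1) 'C(N - j - i, u) * 'C(i, j + u)
    = 'C(N - j - i + i, e))%N.
  rewrite -binomial.Vandermonde.
  rewrite (big_ord_widen N.+1 (fun u => 'C(N - j - i, u) * 'C(i, e - u))%N);
    last lia.
  rewrite [RHS]big_mkcond; apply: eq_bigr => u _ /=; rewrite ltnS.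
  case: leqP => [le_ue|lt_eu]; last by rewrite (@bin_small i) ?muln0 //; lia.
  rewrite -(@bin_sub i (j + u)); last lia.
  by congr (_ * 'C(_, _))%N; lia.
(* If N - j < i, truncation makes [N - j - i + i] differ from [N - j], but then the factor
   ['C(N - j, i)] is zero on both sides. *)
case: (leqP i (N - j)) => [le_i|lt_i]; last first.
  by rewrite (@bin_small (N - j)) // !(muln0, mul0n).
rewrite subnK // mulnCA ei bin_mul_bin; ring.
Qed.

(** * Reduction to exponent zero *)

Local Open Scope ring_scope.

Definition weighted_sum (N : nat) (F : nat -> int) (m j : nat) : int :=
  \sum_(i < N.+1) ('C(N, i) ^ m * trinom N j i)%N%:Z * F i.

(** Induction on m: [trinom_expand] trades one factor ['C(N, i)] for shifted weights whose
    coefficients do not depend on i. *)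
Lemma dvdz_weighted_sum (N : nat) (d : int) (F : nat -> int) (m j : nat) :
  (forall k, (d %| weighted_sum N F 0 k)%Z) -> (d %| weighted_sum N F m j)%Z.
Proof.
move=> d0; elim: m j => [//|m IHm] j.
have -> : weighted_sum N F m.+1 j =
    \sum_(u < N.+1) ('C(N, j) * 'C(N - j, u))%N%:Z * weighted_sum N F m (j + u).
  under eq_bigr => u _ do rewrite mulr_sumr.
  rewrite exchange_big; apply: eq_bigr => i _ /=.
  have le_iN : (i <= N)%N by rewrite -ltnS.
  rewrite expnSr -mulnA trinom_expand // big_distrr /= -[_%:Z]natz.
  rewrite natr_sum mulr_suml; apply: eq_bigr => u _.
  by rewrite natz !PoszM; ring.
by apply: rpred_sum => u _; rewrite dvdz_mull.
Qed.

(* Both sides are the coefficient of 'X^j in (1 - (1 + 'X)) ^+ M. *)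
Lemma sum_alt_bin_bin (R : comNzRingType) (M j : nat) :
  \sum_(i < M.+1) (-1) ^+ i * ('C(M, i) * 'C(i, j))%N%:R
    = (-1) ^+ M * (j == M)%:R :> R.
Proof.
have E : (1 - ('X + 1)) ^+ M = (-1) ^+ M *: 'X^M :> {poly R}.
  by rewrite opprD addrCA subrr addr0 [LHS]exprNn -[RHS]mul_polyC rmorph_sign.
rewrite -coefXn -coefZ -E exprBn coef_sum; apply: eq_bigr => i _.
rewrite expr1n mulr1 -mulrnAr -(rmorph_sign (@polyC R)) coefCM.
congr (_ * _); rewrite addrC exprDn coefMn coef_sum.
under eq_bigr => k _ do rewrite expr1n mul1r coefMn coefXn.
rewrite natrM mulr_natl; congr (_ *+ _).
case: (ltnP j i.+1) => [lt_ji|lt_ij]; last first.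
  rewrite bin_small // big1 // => k _.
  rewrite (gtn_eqF (leq_trans (ltn_ord k) lt_ij)).
  by rewrite mul0rn.
rewrite (bigD1 (Ordinal lt_ji)) //= eqxx big1 ?addr0 // => k ne_kj.
rewrite (_ : (j == k) = false) ?mul0rn //; apply/negbTE; move: ne_kj.
by rewrite -val_eqE /= eq_sym.
Qed.

(** * Dixon-type alternating sums *)

Definition dixon_sum (a d j : nat) : int :=
  \sum_(i < (2 * a).+1)
    (-1) ^+ i * ('C(d + i, d) * 'C(d + (2 * a - i), d) * trinom (2 * a) j i)%N%:Z.

Lemma dixon_sum_gt (a d j : nat) : (a < j)%N -> dixon_sum a d j = 0.
Proof.
move=> lt_aj; apply: big1 => i _.
by rewrite trinom_gt ?muln0 ?mulr0 // ltn_pmul2l.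
Qed.

(** The factor i - j raises the lower index of C(i,j), and N - j - i lowers the upper index of
    C(N-j,i). These factors can be negative, but only where both weights vanish. *)
Lemma trinom_up (N j i : nat) : (j <= N)%N ->
  ((i%:Z - j%:Z) * (N%:Z - j%:Z - i%:Z)) * (trinom N j i)%:Z
  = (j.+1 * (N - j))%N%:Z * (trinom N j.+1 i)%:Z.
Proof.
move=> le_jN; rewrite /trinom.
case: (ltnP i j) => [lt_ij|le_ji].
  by rewrite !(@bin_small i) ?muln0 ?mulr0 // ltnW.
case: (ltnP (N - j) i) => [lt_i|le_i].
  by rewrite !(@bin_small (N - _)) ?mul0n ?mulr0 //; lia.
have E1 := mul_bin_left i j; have E2 := mul_bin_down (N - j) i.
have -> : (N - j.+1 = (N - j).-1)%N by lia.
have -> : i%:Z - j%:Z = (i - j)%N%:Z by lia.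
have -> : N%:Z - j%:Z - i%:Z = (N - j - i)%N%:Z by lia.
rewrite -!PoszM; congr Posz.
transitivity (((i - j) * 'C(i, j)) * ((N - j - i) * 'C(N - j, i)))%N; first ring.
by rewrite -E1 -E2; ring.
Qed.

(* (D + x)(D + N - x) = D (D + N) + x (N - x), and the difference of the values of
   x (N - x) at i and j is (i - j)(N - i - j), which trinom_up absorbs. *)
Lemma trinom_split (N D j i : nat) : (j <= N)%N -> (i <= N)%N ->
  ((D + i) * (D + (N - i)) * trinom N j i =
   (D + j) * (D + (N - j)) * trinom N j i
   + j.+1 * (N - j) * trinom N j.+1 i)%N.
Proof.
move=> le_j le_i; apply/eqP; rewrite -eqz_nat PoszD [X in _ + X]PoszM; apply/eqP.
rewrite -trinom_up // !PoszM !PoszD -!subzn //; ring.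
Qed.

(** Raising d multiplies the i-th term by (d+1+i)(d+1+2a-i)/(d+1)^2. [trinom_split] with D = d+1
    absorbs the numerator at the price of the weight j+1, which is why the sums carry j. *)
Lemma dixon_sum_rec (a d j : nat) : (j <= a)%N ->
  (d.+1 ^ 2)%N%:Z * dixon_sum a d.+1 j =
    ((d.+1 + j) * (d.+1 + (2 * a - j)))%N%:Z * dixon_sum a d j
    + (j.+1 * (2 * a - j))%N%:Z * dixon_sum a d j.+1.
Proof.
move=> le_ja; rewrite !mulr_sumr -big_split; apply: eq_bigr => i _ /=.
have le_i : (i <= 2 * a)%N by rewrite -ltnS.
have S x : (d.+1 * 'C(d.+1 + x, d.+1) = (d.+1 + x) * 'C(d + x, d))%N.
  by rewrite -mul_bin_diag.
rewrite !(mulrCA _ ((-1) ^+ i)) -mulrDr -!PoszM -PoszD; congr (_ * Posz _).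
transitivity ((d.+1 * 'C(d.+1 + i, d.+1)) * (d.+1 * 'C(d.+1 + (2 * a - i), d.+1))
  * trinom (2 * a) j i)%N; first ring.
rewrite !S.
transitivity ('C(d + i, d) * 'C(d + (2 * a - i), d) *
  ((d.+1 + i) * (d.+1 + (2 * a - i)) * trinom (2 * a) j i))%N; first ring.
by rewrite trinom_split //; [ring | lia].
Qed.

Lemma dixon_sum0 (a j : nat) : (j <= a)%N ->
  dixon_sum a 0 j = (-1) ^+ a * (j == a)%:R.
Proof.
move=> le_ja; rewrite /dixon_sum.
under eq_bigr => i _ do rewrite !bin0 !mul1n -natz /trinom.
have E := sum_alt_bin_bin int (2 * a - j) j.
have -> : (j == a) = (j == 2 * a - j)%N by lia.
have -> : (-1) ^+ a * (j == 2 * a - j)%N%:R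
    = (-1) ^+ (2 * a - j) * (j == 2 * a - j)%N%:R :> int.
  case: eqP => [e|]; last by rewrite !mulr0.
  by congr (_ ^+ _ * _); lia.
rewrite -E.
(* The terms with 2a - j < i vanish through ['C(2 * a - j, i)]. *)
rewrite [RHS](big_ord_widen (2 * a).+1
   (fun i => (-1) ^+ i * ('C(2 * a - j, i) * 'C(i, j))%N%:R)) ?ltnS ?leq_subr //.
rewrite [RHS]big_mkcond; apply: eq_bigr => i _; rewrite ltnS.
by case: leqP => // lt_i; rewrite bin_small // mulr0.
Qed.

(** Induction on d for all j at once, since the recurrence involves j+1. The case j = 0 is Dixon's
    theorem for the terminating 3F2(-2a, -2a, d+1; 1, -d-2a; 1). *)
Lemma dixon_sumE (a d j : nat) : (j <= a)%N ->
  dixon_sum a d j = (-1) ^+ a * ('C(a + d, a) * 'C(d + j, j) * 'C(d, a - j))%N%:Z.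
Proof.
elim: d j => [|d IHd] j le_ja.
  rewrite dixon_sum0 // addn0 !add0n !binn !mul1n bin0n subn_eq0.
  by rewrite eqn_leq le_ja natz.
have d2 : (d.+1 ^ 2)%N%:Z != 0 :> int by rewrite eqz_nat expn_eq0.
apply: (mulfI d2); rewrite dixon_sum_rec // IHd //.
have E1 : (d.+1 * 'C(a + d.+1, a) = (a + d.+1) * 'C(a + d, a))%N.
  by rewrite addnS mul_bin_down -addnS addKn.
have E2 k : (d.+1 * 'C(d.+1 + k, k) = (d.+1 + k) * 'C(d + k, k))%N.
  by rewrite addSn mul_bin_down -addSn addnK.
case: (ltngtP j a) le_ja => // [lt_ja|->] _; last first.
  rewrite dixon_sum_gt // mulr0 addr0 subnn !bin0 !muln1.
  rewrite !(mulrCA _ ((-1) ^+ a)) -!PoszM; congr (_ * Posz _).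
  transitivity ((d.+1 * 'C(a + d.+1, a)) * (d.+1 * 'C(d.+1 + a, a)))%N; last ring.
  rewrite E1 E2; have -> : (2 * a - a = a)%N by lia.
  ring.
rewrite IHd // !(mulrCA _ ((-1) ^+ a)) -mulrDr -!PoszM -PoszD; congr (_ * Posz _).
have E3 : (j.+1 * 'C(d + j.+1, j.+1) = (d.+1 + j) * 'C(d + j, j))%N.
  by rewrite addnS -mul_bin_diag.
apply/esym; transitivity ((d.+1 * 'C(a + d.+1, a)) *
  (d.+1 * 'C(d.+1 + j, j)) * 'C(d.+1, a - j))%N; first ring.
transitivity (((d.+1 + j) * (d.+1 + (2 * a - j)) * 'C(a + d, a)
    * 'C(d + j, j) * 'C(d, a - j)
  + (2 * a - j) * 'C(a + d, a) * (j.+1 * 'C(d + j.+1, j.+1)) *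
    'C(d, a - j.+1)))%N; last ring.
rewrite E1 E2 E3.
have [b ab] : exists b, a = (j + b.+1)%N by exists (a - j.+1)%N; lia.
have -> : (a - j = b.+1)%N by lia.
have -> : (a - j.+1 = b)%N by lia.
have -> : (2 * a - j = a + b.+1)%N by lia.
have E4 : (b.+1 * 'C(d, b.+1) + b * 'C(d, b) = d * 'C(d, b))%N.
  rewrite mul_bin_left -mulnDl; case: (leqP b d) => [le_bd|lt_db].
    by rewrite subnK.
  by rewrite bin_small ?muln0.
(* This is what remains of the recurrence once the common factors are removed. *)
have E5 : ((a + d.+1) * 'C(d.+1, b.+1)
    = (d.+1 + (a + b.+1)) * 'C(d, b.+1) + (a + b.+1) * 'C(d, b))%N.
  by rewrite binS; nia.
transitivity ((d.+1 + j) * 'C(a + d, a) * 'C(d + j, j) *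
  ((a + d.+1) * 'C(d.+1, b.+1)))%N; first ring.
by rewrite E5; ring.
Qed.

(** * Application to the Catalan triangle *)

Definition catalan_term (N k : nat) : int :=
  (-1) ^+ k * (catalan_triangle N k * catalan_triangle N (N - k))%N%:Z.

(** Clearing both Catalan denominators leaves the factor (1+i)(1+2n-i), which [trinom_split] with D
    = 1 expands. *)
Lemma catalan_weighted_sum (n j : nat) :
  weighted_sum (2 * n) (catalan_term (2 * n)) 0 j
    * ((2 * n + 1) ^ 2)%N%:Z
  = ((1 + j) * (1 + (2 * n - j)))%N%:Z * dixon_sum n (2 * n) j
    + (j.+1 * (2 * n - j))%N%:Z * dixon_sum n (2 * n) j.+1.
Proof.
case: (leqP j (2 * n)) => [le_j|lt_j]; last first.
  rewrite !dixon_sum_gt ?mulr0 ?addr0; try lia.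
  rewrite /weighted_sum big1 ?mul0r // => i _.
  by rewrite trinom_gt ?muln0 ?mul0r //; lia.
rewrite /weighted_sum mulr_suml !mulr_sumr -big_split; apply: eq_bigr => i _ /=.
have le_i : (i <= 2 * n)%N by rewrite -ltnS.
rewrite expn0 mul1n /catalan_term mulrCA !(mulrCA _ ((-1) ^+ i)).
rewrite -mulrDr -mulrA -!PoszM -PoszD.
congr (_ * Posz _).
have E1 := @catalan_triangleE (2 * n) i le_i.
have E2 := @catalan_triangleE (2 * n) (2 * n - i) (leq_subr _ _).
rewrite subKn // in E2.
transitivity ((catalan_triangle (2 * n) i * (2 * n + 1)) *
  (catalan_triangle (2 * n) (2 * n - i) * (2 * n + 1)) *
  trinom (2 * n) j i)%N; first ring.
rewrite E1 E2.
transitivity ('C(2 * n + i, 2 * n) * 'C(2 * n + (2 * n - i), 2 * n) *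
  ((1 + i) * (1 + (2 * n - i)) * trinom (2 * n) j i))%N; first ring.
by rewrite trinom_split //; ring.
Qed.

(** Of the two factors 2n+1 to cancel, one comes from binom(3n,n) and the other from a Catalan
    triangle entry. *)
Lemma dvdz_catalan_weighted_sum (n j : nat) :
  ((fuss_catalan3 n)%:Z %| weighted_sum (2 * n) (catalan_term (2 * n)) 0 j)%Z.
Proof.
have N2 : ((2 * n + 1) ^ 2)%N%:Z != 0 :> int by rewrite eqz_nat expn_eq0 addn1.
have E := catalan_weighted_sum n j.
have C k : ((2 * n - k + 1) * 'C(2 * n + k, k)
    = catalan_triangle (2 * n) k * (2 * n + 1))%N \/ (2 * n < k)%N.
  case: (leqP k (2 * n)) => [le_k|]; [left | by right].
  by rewrite catalan_triangleE // -(@bin_sub (2 * n + k) k) ?leq_addl // addnK.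
have F : 'C(n + 2 * n, n) = (fuss_catalan3 n * (2 * n + 1))%N.
  by rewrite fuss_catalan3E -mulSn.
case: (ltngtP j n) => [lt_jn|gt_jn|eq_jn].
- have [C1|] := C j; last lia.
  have [C2|] := C j.+1; last lia.
  apply/dvdzP; exists ((-1) ^+ n * (j.+1 *
    (catalan_triangle (2 * n) j * 'C(2 * n, n - j)
    + catalan_triangle (2 * n) j.+1 * 'C(2 * n, n - j.+1)))%N%:Z).
  apply: (mulIf N2); rewrite E !dixon_sumE //; last exact: ltnW.
  rewrite !(mulrCA _ ((-1) ^+ n)) -mulrDr -!mulrA -!PoszM -PoszD; congr (_ * Posz _).
  rewrite F.
  transitivity (fuss_catalan3 n * (2 * n + 1) * j.+1 *
     (((2 * n - j + 1) * 'C(2 * n + j, j)) * 'C(2 * n, n - j)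
     + ((2 * n - j.+1 + 1) * 'C(2 * n + j.+1, j.+1)) * 'C(2 * n, n - j.+1)))%N.
    (* The coefficient 2n - j of the second sum is exactly the numerator that the triangle entry at
       j+1 requires. *)
    have -> : (2 * n - j.+1 + 1 = 2 * n - j)%N by lia.
    ring.
  by rewrite C1 C2; ring.
- move/eqP: E; rewrite !dixon_sum_gt ?mulr0 ?addr0 //; last exact: ltnW.
  by rewrite mulf_eq0 (negbTE N2) orbF => /eqP->; exact: dvdz0.
- have [C1|] := C j; last lia.
  apply/dvdzP; exists ((-1) ^+ n * (j.+1 * (catalan_triangle (2 * n) j))%N%:Z).
  apply: (mulIf N2); rewrite E eq_jn dixon_sumE // dixon_sum_gt // mulr0 addr0.
  rewrite eq_jn in C1.
  rewrite !(mulrCA _ ((-1) ^+ n)) -!mulrA -!PoszM; congr (_ * Posz _).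
  rewrite F subnn bin0.
  transitivity (fuss_catalan3 n * (2 * n + 1) * n.+1 *
     ((2 * n - n + 1) * 'C(2 * n + n, n)))%N; first ring.
  by rewrite C1; ring.
Qed.

Theorem theorem2 (n m : nat) (hm : (0 < m)%N) :
  ((fuss_catalan3 n)%:Z %| catalan_sum (2 * n) m)%Z.
Proof.
case: m hm => // m _.
(* The weight [trinom (2 * n) 0 i] is itself ['C(2 * n, i)], so it supplies one of the powers. *)
have := dvdz_weighted_sum _ _ _ m 0 (dvdz_catalan_weighted_sum n).
congr (_ %| _)%Z; rewrite /catalan_sum big_mkord; apply: eq_bigr => i _.
by rewrite /catalan_term /trinom subn0 bin0 expnSr !PoszM; ring.
Qed.
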